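(* Let $A$ be a finite set with $|A|\ge2$, let $n\ge2$ and $m\ge1$. For any transformation $f$ of $A^n$ and any $e=(e_1,\dots,e_m)\in A^m$, let $h^e$ be the transformation of $A^{n+m}$ with $h^e\in D(f,m)$ and $h^e_{n+i}(x)=e_i$ for all $1\le i\le m$ and all $x\in A^{n+m}$. Then $$\mathcal{L}(h^e)=\mathcal{L}(f|m)+m.$$
   Context: For $N\ge1$, a transformation of $A^N$ is a map $h=(h_1,\dots,h_N):A^N\to A^N$; its coordinate function $h_i:A^N\to A$ is trivial if $h_i(x)=x_i$ for all $x$. An instruction of $A^N$ is a transformation of $A^N$ with at most one nontrivial coordinate function. A program of length $L$ computing $h$ is a sequence of instructions $g^1,\dots,g^L$ of $A^N$ with $h=g^L\circ\cdots\circ g^1$. The procedural complexity $\mathcal{L}(h)$ is the shortest length of a program computing $h$; the identity has procedural complexity $0$. For a transformation $f$ of $A^n$, $D(f,m)$ is the set of transformations $h$ of $A^{n+m}$ such that $h_i(x_1,\dots,x_{n+m})=f_i(x_1,\dots,x_n)$ for all $1\le i\le n$ and all $(x_1,\dots,x_{n+m})\in A^{n+m}$. The shortest length of a program computing $f$ using $m$ memory cells is $\mathcal{L}(f|m):=\min_{h\in D(f,m)}\mathcal{L}(h)$. *)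

(* Defs.v *)
From mathcomp Require Import all_boot.
From mathcomp Require Import fingroup perm.

Set Implicit Arguments.
Unset Strict Implicit.
Unset Printing Implicit Defensive.

Notation state A N := {ffun 'I_N -> A}.
Notation transf A N := {ffun state A N -> state A N}.

Section Programs.
Variables (A : finType) (N : nat).
Implicit Types (g h : transf A N) (p : seq (transf A N)) (x y : state A N).

Definition trivial_coord h (i : 'I_N) : bool := [forall x, h x i == x i].

Definition instruction h : bool := #|[set i | ~~ trivial_coord h i]| <= 1.

(* The head of p is executed first: on [:: g1; ...; gL] this is
   gL \o ... \o g1. *)
Definition run p : transf A N := [ffun x => foldl (fun y g => g y) x p].

Definition computes p h : bool := all instruction p && (run p == h).

Definition computable_in h (L : nat) : bool :=
  [exists p : L.-tuple (transf A N), computes p h].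

(* The instructions generate all transformations, so that the minimum
   defining the procedural complexity is over a nonempty set. *)

Let cmp h := exists p, computes p h.

Let cmp_comp g h : cmp g -> cmp h -> cmp [ffun x => h (g x)].
Proof.
move=> [p /andP[ip /eqP <-]] [q /andP[iq /eqP <-]].
exists (p ++ q); rewrite /computes all_cat ip iq /=.
by apply/eqP/ffunP=> x; rewrite !ffunE foldl_cat.
Qed.

Let cmp_instr (i : 'I_N) h :
  (forall x j, j != i -> h x j = x j) -> cmp h.
Proof.
move=> hi; exists [:: h]; rewrite /computes /= andbT; apply/andP; split.
  rewrite /instruction -(cards1 i); apply/subset_leq_card/subsetP=> j.
  rewrite !inE; apply: contraR => ji; apply/forallP=> x; apply/eqP.
  exact: hi.
by apply/eqP/ffunP=> x; rewrite ffunE.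
Qed.

Let step x y (i : 'I_N) : state A N := [ffun j => if j == i then y i else x j].

Let cmp_tperm_step x y i : cmp [ffun u => tperm x (step x y i) u].
Proof.
apply: (@cmp_instr i) => u j ji; rewrite ffunE.
by case: tpermP => [->|->|//]; rewrite ffunE (negPf ji).
Qed.

Let cmp_tperm x y : cmp [ffun u => tperm x y u].
Proof.
have [k] := ubnP #|[pred j | x j != y j]|.
elim: k x => // k IHk x le_k.
have [->|neq] := eqVneq x y.
  exists [::]; apply/eqP/ffunP=> u.
  by rewrite !ffunE tperm1 perm1.
have /existsP[i ni] : [exists i, x i != y i].
  rewrite -negb_forall; apply: contra neq => /forallP e.
  by apply/eqP/ffunP => i; apply/eqP.
have nxw : x != step x y i.
  by apply: contra ni => /eqP E; rewrite [in x i]E ffunE eqxx.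
have lt_w : #|[pred j | step x y i j != y j]| < k.
  rewrite -ltnS; apply: leq_ltn_trans le_k.
  apply/proper_card/properP; split.
    apply/subsetP=> j; rewrite !inE ffunE; case: (j =P i) => [->|_ //].
    by rewrite eqxx.
  by exists i; rewrite !inE // ffunE !eqxx.
have Hwy := IHk _ lt_w; have Hxw := cmp_tperm_step x y i.
have [<-//|nwy] := eqVneq (step x y i) y.
have -> : [ffun u => tperm x y u] =
  [ffun u => [ffun v => tperm (step x y i) y v]
    ([ffun v => [ffun w => tperm x (step x y i) w]
       ([ffun w => tperm (step x y i) y w] v)] u)] :> transf A N.
  have E : (tperm x y = tperm x (step x y i) ^ tperm (step x y i) y)%g.
    by rewrite tpermJ tpermL tpermD // eq_sym.
  apply/ffunP=> u; rewrite E !ffunE.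
  by rewrite conjgE tpermV !permM.
exact: cmp_comp (cmp_comp Hwy Hxw) Hwy.
Qed.

Let cmp_perm (s : {perm state A N}) : cmp [ffun u => s u].
Proof.
have [ts -> _] := prod_tpermP s; elim: ts => [|t ts IHt].
  by exists [::]; apply/eqP/ffunP=> u; rewrite !ffunE big_nil perm1.
have -> : [ffun u => (\prod_(t0 <- t :: ts) tperm t0.1 t0.2)%g u] =
   [ffun u => [ffun v => (\prod_(t0 <- ts) tperm t0.1 t0.2)%g v]
     ([ffun v => tperm t.1 t.2 v] u)] :> transf A N.
  by apply/ffunP=> u; rewrite !ffunE big_cons permM.
exact: cmp_comp (cmp_tperm _ _) IHt.
Qed.

Let collapse x y : transf A N := [ffun u => if u == x then y else u].

Let cmp_collapse x y : x != y -> cmp (collapse x y).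
Proof.
move=> neq.
have /existsP[i ni] : [exists i, x i != y i].
  rewrite -negb_forall; apply: contra neq => /forallP e.
  by apply/eqP/ffunP => i; apply/eqP.
have nxw : x != step x y i.
  by apply: contra ni => /eqP E; rewrite [in x i]E ffunE eqxx.
have -> : collapse x y =
  [ffun u => [ffun v => tperm y (step x y i) v]
    ([ffun v => collapse x (step x y i)
       ([ffun w => tperm y (step x y i) w] v)] u)].
  have nyx : y != x by rewrite eq_sym.
  have nsx : step x y i != x by rewrite eq_sym.
  apply/ffunP=> u; rewrite !ffunE.
  have -> : (tperm y (step x y i) u == x) = (u == x).
    by rewrite -[X in _ == X](tpermD nyx nsx) (inj_eq perm_inj).
  by case: eqP => _; rewrite ?tpermR ?tpermK.
apply: cmp_comp (cmp_tperm _ _); apply: cmp_comp; first exact: cmp_tperm.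
apply: (@cmp_instr i) => u j ji; rewrite !ffunE.
by case: eqP => [->|//]; rewrite ffunE (negPf ji).
Qed.

Lemma all_computable h : exists p, computes p h.
Proof.
have [k] := ubnP (#|state A N| - #|codom h|).
elim: k h => // k IHk h le_k.
have [/injectiveP inj|/injectivePn[a [b nab hab]]] := boolP (injectiveb h).
  have -> : h = [ffun u => perm inj u] by apply/ffunP=> u; rewrite ffunE permE.
  exact: cmp_perm.
have [z zN] : exists z, z \notin codom h.
  apply/existsP; rewrite -negb_forall; apply/negP=> /forallP all_im.
  have /injectiveP inj : injectiveb h.
    rewrite /injectiveb /dinjectiveb; apply/card_uniqP.
    rewrite size_map -cardE; apply: eq_card => u; rewrite !inE.
    exact: all_im.
  by rewrite (inj _ _ hab) eqxx in nab.
pose h' : transf A N := [ffun u => if u == a then z else h u].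
have sub : codom h \proper codom h'.
  apply/properP; split.
    apply/subsetP=> _ /codomP[u ->]; have [->|nu] := eqVneq u a.
      rewrite hab; apply/codomP; exists b.
      by rewrite ffunE eq_sym (negPf nab).
    by apply/codomP; exists u; rewrite ffunE (negPf nu).
  by exists z => //; apply/codomP; exists a; rewrite ffunE eqxx.
have Hh' : cmp h'.
  apply: IHk; rewrite -ltnS; apply: leq_trans le_k; rewrite ltnS.
  have lt := proper_card sub; apply: ltn_sub2l => //.
  exact: leq_trans lt (max_card _).
have nz : z != h b by apply: contraNneq zN => ->; exact: codom_f.
have -> : h = [ffun u => collapse z (h b) (h' u)].
  apply/ffunP=> u; rewrite !ffunE.
  have [->|_] := eqVneq u a; first by rewrite eqxx.
  by case: eqP => // E; case/negP: zN; rewrite -E codom_f.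
exact: cmp_comp Hh' (cmp_collapse nz).
Qed.

Lemma ex_computable_in h : exists L, computable_in h L.
Proof.
have [p cp] := all_computable h; exists (size p); apply/existsP;
by exists (in_tuple p).
Qed.

Definition complexity h : nat := ex_minn (ex_computable_in h).

End Programs.

Section Memory.
Variables (A : finType) (n m : nat).
Implicit Types (f : transf A n) (h : transf A (n + m)) (e : state A m).

Definition restrict (x : state A (n + m)) : state A n :=
  [ffun i => x (lshift m i)].

Definition extensions f : {set transf A (n + m)} :=
  [set h : transf A (n + m) |
    [forall x, forall i : 'I_n, h x (lshift m i) == f (restrict x) i]].

Definition join_state (u : state A n) (v : state A m) : state A (n + m) :=
  [ffun i => match split i with inl j => u j | inr k => v k end].

Lemma join_statel u v i : join_state u v (lshift m i) = u i.
Proof. by rewrite ffunE (unsplitK (inl i)). Qed.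

Lemma join_stater u v i : join_state u v (rshift n i) = v i.
Proof. by rewrite ffunE (unsplitK (inr i)). Qed.

Lemma ex_extension_complexity f :
  exists L, [exists h in extensions f, complexity h == L].
Proof.
pose h : transf A (n + m) :=
  [ffun x => join_state (f (restrict x)) [ffun i => x (rshift n i)]].
exists (complexity h); apply/existsP; exists h; rewrite eqxx andbT inE.
by apply/forallP=> x; apply/forallP=> i; rewrite ffunE join_statel.
Qed.

Definition memory_complexity f : nat := ex_minn (ex_extension_complexity f).

(* The unique h \in extensions f whose memory cells end up holding e; see
   const_extensionP. *)
Definition const_extension f e : transf A (n + m) :=
  [ffun x => join_state (f (restrict x)) e].

Lemma const_extensionP f e h :
  reflect (h \in extensions f /\ forall i x, h x (rshift n i) = e i)
          (h == const_extension f e).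
Proof.
apply: (iffP eqP) => [->|[]].
  split=> [|i x]; last by rewrite ffunE join_stater.
  rewrite inE; apply/forallP=> x; apply/forallP=> i.
  by rewrite ffunE join_statel.
rewrite inE => /forallP hf he; apply/ffunP=> x; apply/ffunP=> i.
rewrite -[i]splitK ffunE; case: (split i) => j /=.
  by rewrite join_statel; apply/eqP/(forallP (hf x)).
by rewrite join_stater he.
Qed.

End Memory.

Arguments memory_complexity {A n} m f.

(* Main.v *)
Require Import Defs.
From mathcomp Require Import all_boot.

(** The upper bound appends one constant instruction per memory cell. For the
    lower bound, take a program computing [const_extension f e] and a memory
    cell [j]. Since [j] ends up constant, some instruction writes to it; after
    the last such instruction [j] holds its final value [e j]. Hence that
    instruction can be deleted if all later instructions use the constant
    [e j] instead of reading cell [j]; only the final content of [j] changes.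
    Doing this for the [m] memory cells in turn removes [m] instructions and
    leaves a program computing an extension of [f]. *)

Set Implicit Arguments.
Unset Strict Implicit.
Unset Printing Implicit Defensive.

Lemma has_split_last (T : Type) (a : pred T) (s : seq T) :
  has a s -> exists s1 x s2, [/\ s = s1 ++ x :: s2, a x & ~~ has a s2].
Proof.
elim: s => //= x s IHs.
have [/IHs[s1 [y [s2 [-> ay ns2]]]] _|ns] := boolP (has a s).
  by exists (x :: s1), y, s2.
by rewrite orbF => ax; exists [::], x, s.
Qed.

Section Programs.
Variables (A : finType) (N : nat).
Implicit Types (g h : transf A N) (p q : seq (transf A N)) (x y : state A N).

Lemma run_cat p q x : run (p ++ q) x = run q (run p x).
Proof. by rewrite !ffunE foldl_cat. Qed.

Lemma run_cons g p x : run (g :: p) x = run p (g x).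
Proof. by rewrite !ffunE. Qed.

Lemma run_nil x : run [::] x = x.
Proof. by rewrite ffunE. Qed.

Lemma trivial_coordP g i :
  reflect (forall x, g x i = x i) (trivial_coord g i).
Proof. by apply: (iffP forallP) => gi x; apply/eqP. Qed.

Lemma instruction_sub g h :
  (forall i, trivial_coord g i -> trivial_coord h i) ->
  instruction g -> instruction h.
Proof.
move=> sub; apply: leq_trans; apply/subset_leq_card/subsetP=> i.
by rewrite !inE; apply/contra/sub.
Qed.

Lemma complexity_le p h : computes p h -> complexity h <= size p.
Proof.
move=> cp; rewrite /complexity; case: ex_minnP => L _; apply.
by apply/existsP; exists (in_tuple p).
Qed.

Lemma complexity_computes h :
  exists2 p, computes p h & size p = complexity h.
Proof.
rewrite /complexity; case: ex_minnP => L /existsP[p cp] _.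
by exists p; rewrite ?size_tuple.
Qed.

Definition set_coord (j : 'I_N) (c : A) x : state A N :=
  [ffun i => if i == j then c else x i].

Lemma set_coord_instruction j c : instruction [ffun x => set_coord j c x].
Proof.
rewrite /instruction -(cards1 j); apply/subset_leq_card/subsetP=> i.
rewrite !inE; apply: contraR => /negPf ij; apply/trivial_coordP=> x.
by rewrite !ffunE ij.
Qed.

(** The instruction [g] reading [c] in place of cell [j]. Cell [j] itself is left as it is: setting
    it to [c] could add a second nontrivial coordinate. *)
Definition freeze_coord (j : 'I_N) (c : A) g : transf A N :=
  [ffun x : state A N =>
    [ffun i => if i == j then x j else g (set_coord j c x) i]].

Lemma freeze_coord_instruction j c g :
  instruction g -> instruction (freeze_coord j c g).
Proof.
apply: instruction_sub => i /trivial_coordP gi; apply/trivial_coordP=> x.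
by rewrite !ffunE gi ffunE; case: eqP => [->|].
Qed.

Lemma run_freeze_coord j c p x y :
  all (fun g => trivial_coord g j) p -> y = set_coord j c x ->
  run p y = set_coord j c (run (map (freeze_coord j c) p) x).
Proof.
elim: p x y => [|g p IHp] x y /=; first by rewrite !run_nil.
case/andP=> /trivial_coordP gj pj ->; rewrite !run_cons; apply: IHp => //.
apply/ffunP=> i; rewrite [in RHS]ffunE [in RHS]ffunE [in RHS]ffunE.
by case: eqP => [->|//]; rewrite gj ffunE eqxx.
Qed.

Lemma run_trivial_coord j p x :
  all (fun g => trivial_coord g j) p -> run p x j = x j.
Proof.
elim: p x => [|g p IHp] x /=; first by rewrite run_nil.
by case/andP=> /trivial_coordP gj pj; rewrite run_cons IHp.
Qed.

Hypothesis card_A : 1 < #|A|.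

Lemma delete_last_write p j c :
    all (@instruction A N) p -> (forall x, run p x j = c) ->
  exists q, [/\ all (@instruction A N) q, size p = (size q).+1 &
    forall x i, i != j -> run q x i = run p x i].
Proof.
move=> ip pc; have : has (fun g => ~~ trivial_coord g j) p.
  rewrite has_predC; apply/negP=> pj.
  (* Without a write to [j], every initial content of [j] would also be final, so all elements of
     [A] would equal [c]. *)
  have /card_gt1P[a [b [_ _ /eqP[]]]] := card_A.
  have pE d : d = c by rewrite -(pc [ffun=> d]) run_trivial_coord ?ffunE.
  by rewrite (pE a) (pE b).
case/has_split_last => p1 [g [p2 [Ep gj]]]; rewrite has_predC negbK => p2j.
move: ip pc; rewrite {}Ep all_cat /= => /and3P[ip1 ig ip2] pc.
exists (p1 ++ map (freeze_coord j c) p2); split.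
- rewrite all_cat ip1 all_map /=; apply: sub_all ip2 => h.
  exact: freeze_coord_instruction.
- by rewrite !size_cat size_map addnS.
move=> x i /negPf ij; rewrite !run_cat run_cons.
rewrite (@run_freeze_coord j c p2 (run p1 x)) // 1?[RHS]ffunE ?ij //.
(* As [p2] never writes to [j], the value written by [g] is already the final one. *)
have gc : g (run p1 x) j = c.
  by rewrite -(pc x) run_cat run_cons run_trivial_coord.
apply/ffunP=> k; rewrite [RHS]ffunE; case: eqP => [->//|/eqP kj].
(* The only nontrivial coordinate of [g] is [j], so [g] acts on [run p1 x] as [set_coord j c]. *)
move: ig; rewrite /instruction => /card_le1_eqP ig.
have : trivial_coord g k.
  by apply: contraNT kj => gk; apply/eqP/ig; rewrite inE.
by move/trivial_coordP.
Qed.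

(** Each deletion changes the final content of its own cell only. By [uniq js] the remaining cells
    differ from it, so they still end up constant and the deletion can be repeated. *)
Lemma delete_last_writes p (c : 'I_N -> A) js :
    all (@instruction A N) p -> uniq js ->
    (forall x j, j \in js -> run p x j = c j) ->
  exists q, [/\ all (@instruction A N) q, size p = size q + size js &
    forall x i, i \notin js -> run q x i = run p x i].
Proof.
elim: js p => [|j js IHjs] p ip /=; first by exists p; rewrite addn0.
case/andP=> jNjs ujs pc.
have [x|q [iq -> Eq]] := delete_last_write (j := j) (c := c j) ip.
  by rewrite pc ?mem_head.
have [||x k kjs|r [ir -> Er]] := IHjs q => //.
  rewrite Eq ?pc // ?inE ?kjs ?orbT //.
  by apply: contraNneq jNjs => <-.
exists r; split=> // [|x i]; first by rewrite addnS.
by rewrite inE negb_or => /andP[ij ijs]; rewrite Er ?Eq.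
Qed.

End Programs.

Section Memory.
Variables (A : finType) (n m : nat).
Implicit Types (f : transf A n) (h : transf A (n + m)) (e : state A m).

Lemma memory_complexity_le f h :
  h \in extensions m f -> memory_complexity m f <= complexity h.
Proof.
move=> hf; rewrite /memory_complexity; case: ex_minnP => L _; apply.
by apply/existsP; exists h; rewrite hf eqxx.
Qed.

Lemma memory_complexity_extension f :
  exists2 h, h \in extensions m f & complexity h = memory_complexity m f.
Proof.
rewrite /memory_complexity; case: ex_minnP => L /existsP[h /andP[hf /eqP <-]] _.
by exists h.
Qed.

Definition reset_memory e : seq (transf A (n + m)) :=
  [seq [ffun x => set_coord (rshift n k) (e k) x] | k <- enum 'I_m].

Lemma run_reset_memory e x :
  run (reset_memory e) x = join_state (restrict x) e.
Proof.
(* Generalised for the induction to a list [ks] of cells, the memory cells outside it keeping their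
   contents. *)
suff E ks y : run [seq [ffun x => set_coord (rshift n k) (e k) x] | k <- ks] y =
    join_state (restrict y)
      [ffun k => if k \in ks then e k else y (rshift n k)] :> state A (n + m).
  by rewrite E; congr join_state; apply/ffunP=> k; rewrite ffunE mem_enum.
elim: ks y => [|k ks IHks] y.
  rewrite run_nil; apply/ffunP=> i; rewrite -[i]splitK.
  by case: (split i) => j; rewrite /= ?join_statel ?join_stater !ffunE.
rewrite /= run_cons IHks ffunE; congr join_state; apply/ffunP=> i.
  by rewrite !ffunE eq_lrshift.
rewrite !ffunE inE eq_rshift; case: eqP => [->|//] /=.
by case: ifP.
Qed.

(** An optimal extension already leaves the image under [f] in the first [n] cells, and
    [reset_memory] does not touch these. *)
Lemma complexity_const_extension_le f e :
  complexity (const_extension f e) <= memory_complexity m f + m.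
Proof.
have [h hf <-] := memory_complexity_extension f.
have [p /andP[ip /eqP Eh] <-] := complexity_computes h.
have -> : size p + m = size (p ++ reset_memory e).
  by rewrite size_cat size_map size_enum_ord.
apply: complexity_le; rewrite /computes all_cat ip /=; apply/andP; split.
  by apply/allP=> _ /mapP[k _ ->]; exact: set_coord_instruction.
apply/eqP/ffunP=> x; rewrite run_cat run_reset_memory Eh [RHS]ffunE.
congr join_state; apply/ffunP=> i; rewrite ffunE; apply/eqP.
by move: hf; rewrite inE => /forallP/(_ x)/forallP.
Qed.

Lemma memory_complexity_add_le f e :
  1 < #|A| -> memory_complexity m f + m <= complexity (const_extension f e).
Proof.
move=> card_A; have /card_gt0P[a _] := ltnW card_A.
(* An arbitrary state: the final contents of the memory cells do not depend on the input, so they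
   can be read off at [x0]. *)
pose x0 : state A (n + m) := [ffun=> a].
have [p /andP[ip /eqP Ep] <-] := complexity_computes (const_extension f e).
have [hf he] := elimT (const_extensionP f e _) (eqxx (const_extension f e)).
pose js := [seq rshift n k | k <- enum 'I_m].
have ujs : uniq js by rewrite map_inj_uniq ?enum_uniq //; exact: rshift_inj.
have [|q [iq -> Eq]] :=
    delete_last_writes card_A (c := const_extension f e x0) ip ujs.
  by move=> x _ /mapP[k _ ->]; rewrite Ep !he.
rewrite size_map size_enum_ord leq_add2r.
(* The extension of [f] to compare with is [run q]: the first [n] cells are not in [js], so the
   deletions preserve their final contents. *)
apply: leq_trans (complexity_le (h := run q) _); last first.
  by rewrite /computes iq /=.
apply: memory_complexity_le; move: hf; rewrite !inE => /forallP hf.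
apply/forallP=> x; apply/forallP=> i; rewrite Eq.
  by rewrite Ep; exact: (forallP (hf x)).
by apply/mapP=> -[k _ /eqP]; rewrite eq_lrshift.
Qed.

End Memory.

Theorem proposition10 (A : finType) (n m : nat)
    (hA : 2 <= #|A|) (hn : 2 <= n) (hm : 1 <= m)
    (f : transf A n) (e : state A m) :
  complexity (const_extension f e) = memory_complexity m f + m.
Proof.
apply/eqP; rewrite eqn_leq complexity_const_extension_le.
exact: memory_complexity_add_le.
Qed.
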